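(* Let $\phi=\frac{1+\sqrt5}{2}$. Define the vector field $\mathfrak{V}^0=(\mathfrak{V}^0_x,\mathfrak{V}^0_y,\mathfrak{V}^0_z)$ on $\mathbb{R}^3$ by $\mathfrak{V}^0_y(x,y,z)=\mathfrak{V}^0_x(y,z,x)$, $\mathfrak{V}^0_z(x,y,z)=\mathfrak{V}^0_x(z,x,y)$, where $$\begin{aligned} \mathfrak{V}^0_x(x,y,z)={}&2x\sin\tfrac{x}{2}\sin\tfrac{\phi y}{2}\sin\tfrac{z}{2\phi}-2\phi x\sin\tfrac{x}{2\phi}\sin\tfrac{y}{2}\sin\tfrac{\phi z}{2}+2\phi^{-1}x\sin\tfrac{\phi x}{2}\sin\tfrac{y}{2\phi}\sin\tfrac{z}{2}\\ &+2\phi y\sin z+(7-\sqrt5)y\cos\tfrac{x}{2}\cos\tfrac{\phi y}{2}\sin\tfrac{z}{2\phi}\\ &+2\phi^2y\cos\tfrac{x}{2\phi}\cos\tfrac{y}{2}\sin\tfrac{\phi z}{2}+2\sqrt5\,y\cos\tfrac{\phi x}{2}\cos\tfrac{y}{2\phi}\sin\tfrac{z}{2}\\ &-2\phi^{-1}z\sin y-(7+\sqrt5)z\cos\tfrac{x}{2}\sin\tfrac{\phi y}{2}\cos\tfrac{z}{2\phi}\\ &-2\phi^{-2}z\cos\tfrac{\phi x}{2}\sin\tfrac{y}{2\phi}\cos\tfrac{z}{2}-2\sqrt5\,z\cos\tfrac{x}{2\phi}\sin\tfrac{y}{2}\cos\tfrac{\phi z}{2}, \end{aligned}$$ and let $\mathfrak{W}^0=\nabla\times\mathfrak{V}^0$.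 The Taylor series of $\mathfrak{V}^0$ at the origin contains only terms of even compound degree (and that of $\mathfrak{W}^0$ only terms of odd compound degree). The vector field $\mathfrak{Y}=\mathfrak{V}^0+\mathfrak{W}^0$ has icosahedral symmetry, i.e. $\zeta^{-1}\circ\mathfrak{Y}\circ\zeta=\mathfrak{Y}$ for every $\zeta\in\mathbb{I}$, and satisfies $\nabla\times\mathfrak{Y}=\mathfrak{Y}$. The Taylor series of $\mathfrak{V}^0$ at the origin starts with the degree $10$ vector field $\frac{\mathbf{P}}{23224320}$, where $\mathbf{P}=(\varpi_0,\varrho_0,\sigma_0)$, $\varrho_0(x,y,z)=\varpi_0(y,z,x)$, $\sigma_0(x,y,z)=\varpi_0(z,x,y)$, and $$\begin{aligned} \varpi_0={}&-18x^8yz+(84+84\sqrt5)x^6y^3z+(84-84\sqrt5)x^6yz^3-(126+126\sqrt5)x^4y^5z-(126-126\sqrt5)x^4yz^5\\ &+(36+108\sqrt5)x^2y^7z+(36-108\sqrt5)x^2yz^7-504\sqrt5\,x^2y^5z^3+504\sqrt5\,x^2y^3z^5\\ &+(9-5\sqrt5)y^9z+(9+5\sqrt5)yz^9-(120-24\sqrt5)y^7z^3-(120+24\sqrt5)y^3z^7+252y^5z^5. \end{aligned}$$ The Taylor series of $\mathfrak{Y}$ at the origin starts with the degree $9$ vector field $\frac{\mathbf{Q}}{23224320}=\nabla\times\frac{\mathbf{P}}{23224320}\neq\mathbf{0}$.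
   Context: The icosahedral group $\mathbb{I}\subset SO(3)$ is the group of order $60$ generated by the matrices $$\alpha=\begin{pmatrix}-1&0&0\\0&-1&0\\0&0&1\end{pmatrix},\quad \beta=\begin{pmatrix}0&0&1\\1&0&0\\0&1&0\end{pmatrix},\quad \gamma=\begin{pmatrix}\frac12&-\frac{\phi}{2}&\frac{1}{2\phi}\\ \frac{\phi}{2}&\frac{1}{2\phi}&-\frac12\\ \frac{1}{2\phi}&\frac12&\frac{\phi}{2}\end{pmatrix},\qquad \phi=\frac{1+\sqrt5}{2},$$ acting on column vectors of $\mathbb{R}^3$. A vector field is regarded as a map $\mathbb{R}^3\to\mathbb{R}^3$, so $(\zeta^{-1}\circ\mathbf{B}\circ\zeta)(\mathbf{x})=\zeta^{-1}\mathbf{B}(\zeta\mathbf{x})$. For $\mathbf{B}=(u,v,w)$, $\nabla\times\mathbf{B}=\left(\frac{\partial w}{\partial y}-\frac{\partial v}{\partial z},\frac{\partial u}{\partial z}-\frac{\partial w}{\partial x},\frac{\partial v}{\partial x}-\frac{\partial u}{\partial y}\right)$. Compound degree means total degree in $x,y,z$. ''The Taylor series starts with a degree $d$ vector field'' means that this field is the lowest-degree nonzero homogeneous component of the Taylor series at the origin. *)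

(* Defs.v *)
From mathcomp Require Import all_boot all_order all_algebra.
From mathcomp Require Import all_classical all_reals all_analysis.

Set Implicit Arguments.
Unset Strict Implicit.
Unset Printing Implicit Defensive.

Import Order.TTheory GRing.Theory Num.Theory.
Import numFieldNormedType.Exports.

Local Open Scope ring_scope.

Definition vfield (R : realType) := 'cV[R]_3 -> 'cV[R]_3.

Definition vec3 (R : realType) (a b c : R) : 'cV[R]_3 :=
  \col_(i < 3) [:: a; b; c]`_i.

Definition mx3 (R : realType) (rows : seq (seq R)) : 'M[R]_3 :=
  \matrix_(i < 3, j < 3) (nth [::] rows i)`_j.

Definition addvf (R : realType) (F G : vfield R) : vfield R :=
  fun p => F p + G p.

Definition scalevf (R : realType) (c : R) (F : vfield R) : vfield R :=
  fun p => c *: F p.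

Definition component (R : realType) (F : vfield R) (i : 'I_3) : 'cV[R]_3 -> R :=
  fun p => F p i 0.

(* ['D_v f] is a total operator; it is the directional derivative wherever that
   derivative exists, which is everywhere for the smooth fields below. *)
Definition partial (R : realType) (i : 'I_3) (f : 'cV[R]_3 -> R) :
    'cV[R]_3 -> R :=
  fun p => 'D_(delta_mx i 0) f p.

Definition curl (R : realType) (F : vfield R) : vfield R :=
  let u := component F 0 in
  let v := component F 1 in
  let w := component F 2 in
  fun p => vec3 (partial 1 w p - partial 2 v p)
                (partial 2 u p - partial 0 w p)
                (partial 0 v p - partial 1 u p).

(* The field (f(x,y,z), f(y,z,x), f(z,x,y)). *)
Definition cyclic_field (R : realType) (f : R -> R -> R -> R) : vfield R :=
  fun p => let x := p 0 0 in let y := p 1 0 in let z := p 2 0 in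
    vec3 (f x y z) (f y z x) (f z x y).

(* The coefficient of x^a y^b z^c in the Taylor series of [f] at the origin. *)
Definition taylor_coef (R : realType) (f : 'cV[R]_3 -> R) (a b c : nat) : R :=
  iter a (partial 0) (iter b (partial 1) (iter c (partial 2) f)) 0
    / (a`! * b`! * c`!)%N%:R.

Definition taylor_part (R : realType) (f : 'cV[R]_3 -> R) (d : nat) :
    'cV[R]_3 -> R :=
  fun p => \sum_(a < d.+1) \sum_(b < d.+1) \sum_(c < d.+1 | (a + b + c == d)%N)
    taylor_coef f a b c * p 0 0 ^+ a * p 1 0 ^+ b * p 2 0 ^+ c.

Definition taylor_component (R : realType) (F : vfield R) (d : nat) : vfield R :=
  fun p => \col_(i < 3) taylor_part (component F i) d p.

Definition taylor_only_even (R : realType) (F : vfield R) : Prop :=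
  forall (i : 'I_3) (a b c : nat),
    odd (a + b + c)%N -> taylor_coef (component F i) a b c = 0.

Definition taylor_only_odd (R : realType) (F : vfield R) : Prop :=
  forall (i : 'I_3) (a b c : nat),
    ~~ odd (a + b + c)%N -> taylor_coef (component F i) a b c = 0.

Definition taylor_starts_with (R : realType) (F : vfield R) (d : nat)
    (G : vfield R) : Prop :=
  [/\ forall e p, (e < d)%N -> taylor_component F e p = 0,
      forall p, taylor_component F d p = G p
    & exists p, G p <> 0].

Definition golden (R : realType) : R := (1 + Num.sqrt 5) / 2.

Definition icos_alpha (R : realType) : 'M[R]_3 :=
  mx3 [:: [:: -1;  0; 0];
          [::  0; -1; 0];
          [::  0;  0; 1]].

Definition icos_beta (R : realType) : 'M[R]_3 :=
  mx3 [:: [:: 0; 0; 1];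
          [:: 1; 0; 0];
          [:: 0; 1; 0]].

Definition icos_gamma (R : realType) : 'M[R]_3 :=
  let phi := golden R in
  mx3 [:: [:: 1 / 2;         - (phi / 2);     1 / (2 * phi)];
          [:: phi / 2;       1 / (2 * phi);   - (1 / 2)];
          [:: 1 / (2 * phi); 1 / 2;           phi / 2]].

Inductive icosahedral (R : realType) : 'M[R]_3 -> Prop :=
| icos_gen_alpha : icosahedral (icos_alpha R)
| icos_gen_beta : icosahedral (icos_beta R)
| icos_gen_gamma : icosahedral (icos_gamma R)
| icos_one : icosahedral 1%:M
| icos_mul (A B : 'M[R]_3) :
    icosahedral A -> icosahedral B -> icosahedral (A *m B)
| icos_inv (A : 'M[R]_3) : icosahedral A -> icosahedral (invmx A).

Definition icosahedral_symmetry (R : realType) (F : vfield R) : Prop :=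
  forall zeta : 'M[R]_3, icosahedral zeta ->
    forall p, invmx zeta *m F (zeta *m p) = F p.

Definition V0x (R : realType) (x y z : R) : R :=
  let phi := golden R in
  let s5 : R := Num.sqrt 5 in
    2 * x * sin (x / 2) * sin (phi * y / 2) * sin (z / (2 * phi))
  - 2 * phi * x * sin (x / (2 * phi)) * sin (y / 2) * sin (phi * z / 2)
  + 2 * phi^-1 * x * sin (phi * x / 2) * sin (y / (2 * phi)) * sin (z / 2)
  + 2 * phi * y * sin z
  + (7 - s5) * y * cos (x / 2) * cos (phi * y / 2) * sin (z / (2 * phi))
  + 2 * phi ^+ 2 * y * cos (x / (2 * phi)) * cos (y / 2) * sin (phi * z / 2)
  + 2 * s5 * y * cos (phi * x / 2) * cos (y / (2 * phi)) * sin (z / 2)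
  - 2 * phi^-1 * z * sin y
  - (7 + s5) * z * cos (x / 2) * sin (phi * y / 2) * cos (z / (2 * phi))
  - 2 * phi ^- 2 * z * cos (phi * x / 2) * sin (y / (2 * phi)) * cos (z / 2)
  - 2 * s5 * z * cos (x / (2 * phi)) * sin (y / 2) * cos (phi * z / 2).

Definition V0 (R : realType) : vfield R := cyclic_field (@V0x R).
Arguments V0 R : clear implicits.

Definition W0 (R : realType) : vfield R := curl (V0 R).
Arguments W0 R : clear implicits.

Definition Y0 (R : realType) : vfield R := addvf (V0 R) (W0 R).
Arguments Y0 R : clear implicits.

Definition varpi0 (R : realType) (x y z : R) : R :=
  let s5 : R := Num.sqrt 5 in
  - 18 * x ^+ 8 * y * z
  + (84 + 84 * s5) * x ^+ 6 * y ^+ 3 * z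
  + (84 - 84 * s5) * x ^+ 6 * y * z ^+ 3
  - (126 + 126 * s5) * x ^+ 4 * y ^+ 5 * z
  - (126 - 126 * s5) * x ^+ 4 * y * z ^+ 5
  + (36 + 108 * s5) * x ^+ 2 * y ^+ 7 * z
  + (36 - 108 * s5) * x ^+ 2 * y * z ^+ 7
  - 504 * s5 * x ^+ 2 * y ^+ 5 * z ^+ 3
  + 504 * s5 * x ^+ 2 * y ^+ 3 * z ^+ 5
  + (9 - 5 * s5) * y ^+ 9 * z
  + (9 + 5 * s5) * y * z ^+ 9
  - (120 - 24 * s5) * y ^+ 7 * z ^+ 3
  - (120 + 24 * s5) * y ^+ 3 * z ^+ 7
  + 252 * y ^+ 5 * z ^+ 5.

Definition P0 (R : realType) : vfield R := cyclic_field (@varpi0 R).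
Arguments P0 R : clear implicits.

(* 23224320, split by digit groups because a ring numeral is a unary [nat]. *)
Definition norm_const (R : realType) : R :=
  23 * 10 ^+ 6 + 224 * 10 ^+ 3 + 320.

(* P / 23224320 *)
Definition P0n (R : realType) : vfield R := scalevf (norm_const R)^-1 (P0 R).
Arguments P0n R : clear implicits.

Definition Q0 (R : realType) : vfield R := curl (P0 R).
Arguments Q0 R : clear implicits.

(* Q / 23224320 *)
Definition Q0n (R : realType) : vfield R := scalevf (norm_const R)^-1 (Q0 R).
Arguments Q0n R : clear implicits.

(* Main.v *)
Require Import Defs.
From mathcomp Require Import all_boot all_order all_algebra.
From mathcomp Require Import all_classical all_reals all_analysis.
From mathcomp Require Import ring lra zify.
Import Order.TTheory GRing.Theory Num.Theory.
Import numFieldNormedType.Exports.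
Local Open Scope ring_scope.
Set Implicit Arguments.
Unset Strict Implicit.
Unset Printing Implicit Defensive.

(** The rotation [gamma] has order 5, and [V0] is the sum over the powers of
    [gamma] of the rotated copies of one elementary field, the swirl
    S = (2 phi y sin z - 2 phi^-1 z sin y, and cyclically).  The axis of [gamma]
    is proportional to (1, 0, phi), so the three coordinate axes make three
    different angles with it; their orbits under [gamma] are therefore disjoint
    and form the 15 twofold axes of the icosahedral group.  Each product of three
    trigonometric functions in [V0] collects waves along four of these axes
    ([V0_gamma_sum], proved with the addition formulas).

    Symmetry and the eigenfield equation both follow.  The sum is invariant under
    [gamma] because gamma^5 = 1, and [V0] is invariant under the other two
    generators by inspection.  The curl commutes with rotations
    ([curl_rotated]), and curl (curl S) = S is a direct computation
    ([curl_curl_swirl]), hence curl (curl V0) = V0.  So Y = V0 + curl V0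
    satisfies curl Y = Y, and it inherits the symmetry of [V0]
    ([icosahedral_symmetry_Y0]).

    For the Taylor series, the first component of [V0] is a sum of eleven
    products f(x) g(y) h(z), in which each factor is a sine or a cosine, possibly
    multiplied by its variable.  All mixed partial derivatives at 0 are therefore
    explicit.  Only monomials x^a y^b z^c with a even and b, c odd occur, and
    their coefficients are evaluated in Q(sqrt 5): they vanish for
    a + b + c < 10 and give P for a + b + c = 10.  Since the degree d part of
    curl F is the curl of the degree d + 1 part of F
    ([taylor_component_curl]), the statements on W and Y need no
    further coefficient.  The fields P and Q are nonzero at (0, 1, 1) and
    (1, 0, 0) respectively. *)

(** * Directional derivatives *)

(** The difference quotients of [f \o L] at [p] along [v] are those of [f] at
    [L p] along [L v], so [L] need not be continuous. *)
Lemma is_derive_comp_linear {R : realType} {U V W : normedModType R}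
    (L : U -> V) (f : V -> W) (p v : U) (d : W) : linear L ->
  is_derive (L p) (L v) f d -> is_derive p v (fun q => f (L q)) d.
Proof.
move=> linL.
have E : (fun h : R => h^-1 *: (((fun q => f (L q)) \o shift p) (h *: v) - f (L p)))
       = (fun h : R => h^-1 *: ((f \o shift (L p)) (h *: L v) - f (L p))).
  by apply/funext => h /=; rewrite linL.
by case=> df <-; split; rewrite /derivable /derive E.
Qed.

Lemma is_derive_dir {R : realType} (u : R -> R) (t w d : R) :
  is_derive t 1 u d -> is_derive t w u (d * w).
Proof.
case=> /derivable1_diffP du <-; split; first exact: diff_derivable.
have -> : w = w *: (1 : R) by rewrite /GRing.scale /= mulr1.
by rewrite !deriveE // linearZ mulrC [in RHS]/GRing.scale /= mulr1.
Qed.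

Lemma is_derive_coord {R : realType} (u : R -> R) (j : 'I_3) (p v : 'cV[R]_3) (d : R) :
  is_derive (p j 0) 1 u d ->
  is_derive p v (fun q : 'cV[R]_3 => u (q j 0)) (d * v j 0).
Proof.
move=> /is_derive_dir du.
apply: (@is_derive_comp_linear R _ _ _ (fun q : 'cV[R]_3 => q j 0) u) => //.
by move=> h x y; rewrite !mxE.
Qed.

Lemma is_derive_mul {R : realType} (V : normedModType R) (f g : V -> R) (p v : V)
    (df dg : R) :
  is_derive p v f df -> is_derive p v g dg ->
  is_derive p v (fun q => f q * g q) (df * g p + f p * dg).
Proof.
move=> Df Dg; apply: (is_derive_eq (is_deriveM Df Dg)).
by rewrite /GRing.scale /=; ring.
Qed.

(** * Jets: families of all derivatives *)

Definition is_jet {R : realType} (u : nat -> R -> R) :=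
  forall (n : nat) (t : R), is_derive t 1 (u n) (u n.+1 t).

(** [F a b c] is the partial derivative of [F 0 0 0] of orders [a], [b], [c].
    Arbitrary directions [v] are allowed because rotating a field mixes the
    partial derivatives; existence of the three partial derivatives would not
    give the directional ones. *)
Definition is_jet3 {R : realType} (F : nat -> nat -> nat -> 'cV[R]_3 -> R) :=
  forall a b c p v, is_derive p v (F a b c)
    (F a.+1 b c p * v 0 0 + F a b.+1 c p * v 1 0 + F a b c.+1 p * v 2 0).

Definition smooth {R : realType} (f : 'cV[R]_3 -> R) :=
  exists2 G, is_jet3 G & f = G 0 0 0.

Definition smooth_field {R : realType} (F : vfield R) :=
  forall i, smooth (component F i).

Lemma is_jet3_prod {R : realType} (u v w : nat -> R -> R) :
  is_jet u -> is_jet v -> is_jet w ->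
  is_jet3 (fun a b c p => u a (p 0 0) * v b (p 1 0) * w c (p 2 0)).
Proof.
move=> ju jv jw a b c p d.
have du := is_derive_coord d (ju a (p 0 0)).
have dv := is_derive_coord d (jv b (p 1 0)).
have dw := is_derive_coord d (jw c (p 2 0)).
by apply: (is_derive_eq (is_derive_mul (is_derive_mul du dv) dw)); ring.
Qed.

Lemma is_jet3D {R : realType} (F G : nat -> nat -> nat -> 'cV[R]_3 -> R) :
  is_jet3 F -> is_jet3 G -> is_jet3 (fun a b c p => F a b c p + G a b c p).
Proof.
move=> jF jG a b c p d.
by apply: (is_derive_eq (is_deriveD (jF a b c p d) (jG a b c p d))); ring.
Qed.

Lemma is_jet3Z {R : realType} (k : R) (F : nat -> nat -> nat -> 'cV[R]_3 -> R) :
  is_jet3 F -> is_jet3 (fun a b c p => k * F a b c p).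
Proof.
move=> jF a b c p d.
apply: (is_derive_eq (is_deriveZ k (jF a b c p d))).
by rewrite /GRing.scale /=; ring.
Qed.

Lemma is_jet3_sum {R : realType} (I : Type) (r : seq I) (P : pred I)
    (F : I -> nat -> nat -> nat -> 'cV[R]_3 -> R) :
  (forall i, is_jet3 (F i)) ->
  is_jet3 (fun a b c p => \sum_(i <- r | P i) F i a b c p).
Proof.
move=> jF; elim: r => [|i r IH] a b c p d.
  under eq_fun do rewrite big_nil.
  by rewrite !big_nil !mul0r !addr0; exact: is_derive_cst.
under eq_fun do rewrite big_cons.
by rewrite !big_cons; case: ifP => _; [exact: (is_jet3D (jF i) IH) | exact: IH].
Qed.

Lemma is_jet3_shift {R : realType} (F : nat -> nat -> nat -> 'cV[R]_3 -> R) i j l :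
  is_jet3 F -> is_jet3 (fun a b c => F (i + a)%N (j + b)%N (l + c)%N).
Proof. by move=> jF a b c; rewrite !addnS; exact: jF. Qed.

Lemma is_jet3_partial {R : realType} (F : nat -> nat -> nat -> 'cV[R]_3 -> R) a b c :
  is_jet3 F ->
  [/\ partial 0 (F a b c) = F a.+1 b c,
      partial 1 (F a b c) = F a b.+1 c & partial 2 (F a b c) = F a b c.+1].
Proof.
move=> jF; split; apply/funext => p; rewrite /partial;
  set v := delta_mx _ _; case: (jF a b c p v) => _ ->;
  by rewrite !mxE /= ?mulr0 ?mulr1 ?add0r ?addr0.
Qed.

Lemma iter_partial_jet3 {R : realType} (F : nat -> nat -> nat -> 'cV[R]_3 -> R) a b c :
  is_jet3 F ->
  iter a (partial 0) (iter b (partial 1) (iter c (partial 2) (F 0 0 0))) = F a b c.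
Proof.
move=> jF.
have -> : iter c (partial 2) (F 0 0 0) = F 0 0 c.
  by elim: c => //= c ->; have [] := is_jet3_partial 0 0 c jF.
have -> : iter b (partial 1) (F 0 0 c) = F 0 b c.
  by elim: b => //= b ->; have [] := is_jet3_partial 0 b c jF.
by elim: a => //= a ->; have [] := is_jet3_partial a b c jF.
Qed.

Lemma taylor_coef_jet3 {R : realType} (F : nat -> nat -> nat -> 'cV[R]_3 -> R) a b c :
  is_jet3 F -> taylor_coef (F 0 0 0) a b c = F a b c 0 / (a`! * b`! * c`!)%N%:R.
Proof. by move=> jF; rewrite /taylor_coef iter_partial_jet3. Qed.

Definition sin_diff {R : realType} (m : nat) (t : R) : R :=
  (-1) ^+ m./2 * (if odd m then cos t else sin t).

Lemma is_jet_sin_diff {R : realType} : is_jet (@sin_diff R).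
Proof.
move=> m t; rewrite /sin_diff /= uphalf_half.
case: (odd m) => /=.
  apply: (is_derive_eq (is_deriveZ ((-1) ^+ m./2) (is_derive_cos t))).
  by rewrite /GRing.scale /= exprS; ring.
by apply: (is_derive_eq (is_deriveZ ((-1) ^+ m./2) (is_derive_sin t))).
Qed.

Lemma is_jet_scale {R : realType} (k : R) (u : nat -> R -> R) :
  is_jet u -> is_jet (fun n t => k ^+ n * u n (k * t)).
Proof.
move=> ju n t.
have linL : linear ( *%R k : R -> R) by move=> h x y; rewrite /GRing.scale /=; ring.
have dL := is_derive_comp_linear (p := t) linL (is_derive_dir (k * 1) (ju n (k * t))).
apply: (is_derive_eq (is_deriveZ (k ^+ n) dL)).
by rewrite /GRing.scale /= exprS; ring.
Qed.

(** The jet of t |-> sin (k t) if [s], and of t |-> cos (k t) otherwise: the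
    cosine is the first derivative of the sine, whence the shift by [~~ s].  The
    constant 1 is the case of the cosine with k = 0. *)
Definition trig_jet {R : realType} (s : bool) (k : R) (n : nat) (t : R) : R :=
  k ^+ n * sin_diff (n + ~~ s) (k * t).

Lemma is_jet_trig {R : realType} s (k : R) : is_jet (trig_jet s k).
Proof.
apply: (is_jet_scale k (u := fun n => sin_diff (n + ~~ s))).
by move=> n t; exact: is_jet_sin_diff.
Qed.

Definition mulX_jet {R : realType} (u : nat -> R -> R) (n : nat) (t : R) : R :=
  t * u n t + n%:R * u n.-1 t.

Lemma is_jet_mulX {R : realType} (u : nat -> R -> R) : is_jet u -> is_jet (mulX_jet u).
Proof.
move=> ju n t.
apply: (is_derive_eq (is_deriveD (is_derive_mul (is_derive_id t 1) (ju n t))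
  (is_deriveZ n%:R (ju n.-1 t)))).
rewrite /mulX_jet /GRing.scale /=; case: n => [|n] /=; first by ring.
by rewrite -[n.+2%:R]natr1; ring.
Qed.

Definition pow_jet {R : realType} (n m : nat) (t : R) : R :=
  (n ^_ m)%:R * t ^+ (n - m).

Lemma is_jet_pow {R : realType} n : is_jet (@pow_jet R n).
Proof.
move=> m t; rewrite /pow_jet.
have E : (fun s : R => (n ^_ m)%:R * s ^+ (n - m)) = (n ^_ m)%:R \*: (id ^+ (n - m)).
  by apply/funext => s; rewrite !fctE.
rewrite E; apply: is_derive_eq.
by rewrite /GRing.scale /= ffactnSr natrM subnS; ring.
Qed.

(** * Vectors and matrices of size three *)

Lemma ord3_ind (P : 'I_3 -> Prop) : P 0 -> P 1 -> P 2 -> forall i, P i.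
Proof.
by move=> P0 P1 P2 [[|[|[|]]]] //= lti;
  [move: P0 | move: P1 | move: P2]; congr P; apply: val_inj.
Qed.

Lemma sum_ord3 {R : realType} (f : 'I_3 -> R) : \sum_i f i = f 0 + f 1 + f 2.
Proof.
rewrite !big_ord_recl big_ord0 addr0 addrA.
by congr (_ + f _ + f _); apply: val_inj.
Qed.

(** Indexing the entries by naturals makes the many representations of one
    ordinal ([lift], [bump], numerals) agree by computation. *)
Lemma mx_natE {R : realType} m n (A : 'M[R]_(m.+1, n.+1)) :
  exists a : nat -> nat -> R, forall i j, A i j = a i j.
Proof.
by exists (fun i j => A (inord i) (inord j)) => i j; rewrite !inord_val.
Qed.

Lemma det_mx22 {R : realType} (A : 'M[R]_2) : \det A = A 0 0 * A 1 1 - A 0 1 * A 1 0.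
Proof.
rewrite (expand_det_row _ 0) !big_ord_recl big_ord0 /cofactor !det_mx11 !mxE /=.
by have [a aE] := mx_natE A; rewrite !aE /= /bump /= expr0 expr1; ring.
Qed.

Lemma det_mx33 {R : realType} (A : 'M[R]_3) :
  \det A = A 0 0 * (A 1 1 * A 2 2 - A 1 2 * A 2 1)
         - A 0 1 * (A 1 0 * A 2 2 - A 1 2 * A 2 0)
         + A 0 2 * (A 1 0 * A 2 1 - A 1 1 * A 2 0).
Proof.
rewrite (expand_det_row _ 0) !big_ord_recl big_ord0 /cofactor !det_mx22 !mxE /=.
have [a aE] := mx_natE A.
by rewrite !aE /= /bump /= expr0 expr1 sqrrN expr1n; ring.
Qed.

(** * Jacobians, rotations and the curl *)

Definition jacobian {R : realType} (F : vfield R) (p : 'cV[R]_3) : 'M[R]_3 :=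
  \matrix_(i, j) partial j (component F i) p.

(** Every directional derivative exists and is linear in the direction.  This is
    weaker than differentiability but suffices for the chain rule along a
    rotation, and avoids continuity arguments. *)
Definition gateaux_field {R : realType} (F : vfield R) :=
  forall i p v, is_derive p v (component F i) ((jacobian F p *m v) i 0).

(** The vector of the antisymmetric part of a matrix, normalised so that the
    curl is the axial vector of the Jacobian. *)
Definition axial {R : realType} (A : 'M[R]_3) : 'cV[R]_3 :=
  vec3 (A 2 1 - A 1 2) (A 0 2 - A 2 0) (A 1 0 - A 0 1).

Lemma curlE {R : realType} (F : vfield R) p : curl F p = axial (jacobian F p).
Proof. by rewrite /curl /axial !mxE. Qed.

Lemma jacobianP {R : realType} (F : vfield R) (J : 'cV[R]_3 -> 'M[R]_3) :
  (forall i p v, is_derive p v (component F i) ((J p *m v) i 0)) ->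
  gateaux_field F /\ jacobian F = J.
Proof.
move=> dF; have E : jacobian F = J.
  apply/funext => p; apply/matrixP => i j; rewrite mxE /partial.
  by have [_ ->] := dF i p (delta_mx j 0); rewrite -colE mxE.
by split=> //; rewrite /gateaux_field E.
Qed.

Lemma smooth_gateaux {R : realType} (F : vfield R) : smooth_field F -> gateaux_field F.
Proof.
move=> sF i p v; have [G jG FG] := sF i.
have [d0 d1 d2] := is_jet3_partial 0 0 0 jG.
by rewrite mxE sum_ord3 !mxE FG d0 d1 d2; exact: jG.
Qed.

Lemma gateaux_curl0 {R : realType} :
  gateaux_field (fun _ => 0 : 'cV[R]_3) /\ curl (fun _ => 0) = (fun _ => 0) :> vfield R.
Proof.
have [d0 J0] : gateaux_field (fun _ => 0 : 'cV[R]_3) /\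
    jacobian (fun _ => 0 : 'cV[R]_3) = fun _ => 0.
  apply: jacobianP => i p v; rewrite mul0mx mxE.
  have -> : component (fun _ : 'cV[R]_3 => (0 : 'cV[R]_3)) i = cst 0.
    by apply/funext => q; rewrite /component mxE.
  exact: is_derive_cst.
split=> //; apply/funext => p; rewrite curlE J0.
by apply/matrixP; apply: ord3_ind => j; rewrite !mxE /= ?mxE subrr.
Qed.

Lemma addvf_jacobian {R : realType} (F G : vfield R) :
  gateaux_field F -> gateaux_field G ->
  gateaux_field (Defs.addvf F G) /\
  jacobian (Defs.addvf F G) = fun p => jacobian F p + jacobian G p.
Proof.
move=> dF dG; apply: jacobianP => i p v.
have -> : component (Defs.addvf F G) i = component F i + component G i.
  by apply/funext => q; rewrite /component mxE.
by rewrite mulmxDl mxE; exact: is_deriveD.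
Qed.

Lemma curlD {R : realType} (F G : vfield R) :
  gateaux_field F -> gateaux_field G ->
  curl (Defs.addvf F G) = Defs.addvf (curl F) (curl G).
Proof.
move=> dF dG; apply/funext => p; rewrite /Defs.addvf !curlE.
have [_ ->] := addvf_jacobian dF dG.
by apply/matrixP; apply: ord3_ind => j; rewrite !mxE /=; ring.
Qed.

Lemma curl_scale {R : realType} (k : R) (F : vfield R) :
  gateaux_field F -> curl (scalevf k F) = scalevf k (curl F).
Proof.
move=> dF; have E : jacobian (scalevf k F) = fun p => k *: jacobian F p.
  apply: (jacobianP _).2 => i p v.
  have -> : component (scalevf k F) i = k \*: component F i.
    by apply/funext => q; rewrite /component mxE.
  by rewrite -scalemxAl mxE; apply: is_deriveZ.
apply/funext => p; rewrite /scalevf !curlE E.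
by apply/matrixP; apply: ord3_ind => j; rewrite !mxE /=; ring.
Qed.

Lemma gateaux_curl_sum {R : realType} (n : nat) (F : nat -> vfield R) :
  (forall j, gateaux_field (F j)) ->
  gateaux_field (fun p => \sum_(j < n) F j p) /\
  curl (fun p => \sum_(j < n) F j p) = fun p => \sum_(j < n) curl (F j) p.
Proof.
move=> dF; elim: n => [|n [IHd IHc]].
  have sum0 (G : nat -> vfield R) : (fun p => \sum_(j < 0) G j p) = fun _ => 0.
    by apply/funext => p; rewrite big_ord0.
  by rewrite (sum0 F) (sum0 (fun j => curl (F j))); exact: gateaux_curl0.
have E : (fun p => \sum_(j < n.+1) F j p) =
    Defs.addvf (fun p => \sum_(j < n) F j p) (F n).
  by apply/funext => p; rewrite big_ord_recr.
rewrite E; split; first by have [] := addvf_jacobian IHd (dF n).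
by rewrite curlD // IHc; apply/funext => p; rewrite big_ord_recr.
Qed.

Definition rotated {R : realType} (M : 'M[R]_3) (F : vfield R) : vfield R :=
  fun p => M *m F (M^T *m p).

Lemma rotated_mul {R : realType} (A B : 'M[R]_3) (F : vfield R) :
  rotated (A *m B) F = rotated A (rotated B F).
Proof. by apply/funext => p; rewrite /rotated trmx_mul !mulmxA. Qed.

Lemma rotated_sum {R : realType} (M : 'M[R]_3) n (F : nat -> vfield R) :
  rotated M (fun p => \sum_(j < n) F j p) = fun p => \sum_(j < n) rotated M (F j) p.
Proof. by apply/funext => p; rewrite /rotated mulmx_sumr. Qed.

Lemma rotated_jacobian {R : realType} (M : 'M[R]_3) (F : vfield R) :
  gateaux_field F -> gateaux_field (rotated M F) /\
  jacobian (rotated M F) = fun p => M *m jacobian F (M^T *m p) *m M^T.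
Proof.
move=> dF; apply: jacobianP => i p v.
have -> : component (rotated M F) i =
    \sum_(j < 3) (fun q => M i j *: component F j (M^T *m q)).
  by apply/funext => q; rewrite fct_sumE /component mxE.
have linM : linear (fun q : 'cV[R]_3 => M^T *m q).
  by move=> h x y; rewrite mulmxDr -scalemxAr.
rewrite -mulmxA -mulmxA mxE; apply: is_derive_sum => j.
by apply: is_deriveZ; exact: (is_derive_comp_linear linM).
Qed.

Definition rotation {R : realType} (M : 'M[R]_3) := M *m M^T = 1%:M /\ \det M = 1.

Lemma rotationM {R : realType} (A B : 'M[R]_3) :
  rotation A -> rotation B -> rotation (A *m B).
Proof.
move=> [oA dA] [oB dB]; split; last by rewrite det_mulmx dA dB mulr1.
by rewrite trmx_mul mulmxA -[A *m B *m _]mulmxA oB mulmx1.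
Qed.

Lemma rotation1 {R : realType} : rotation (1%:M : 'M[R]_3).
Proof. by split; rewrite ?trmx1 ?mulmx1 ?det1. Qed.

Lemma rotation_exp {R : realType} (M : 'M[R]_3) n : rotation M -> rotation (M ^+ n).
Proof.
move=> rM; elim: n => [|n IH]; first by rewrite expr0; exact: rotation1.
by rewrite exprS; exact: rotationM.
Qed.

Lemma rotation_trC {R : realType} (M : 'M[R]_3) : rotation M -> M^T *m M = 1%:M.
Proof. by case=> /mulmx1C. Qed.

(** The cofactor identity (M u) x (M v) = det M M^-T (u x v), in the form that is
    polynomial in the entries: it holds for every [M], so [ring] proves it. *)
Lemma tr_mul_axial {R : realType} (M A : 'M[R]_3) :
  M^T *m axial (M *m A *m M^T) = \det M *: axial A.
Proof.
apply/matrixP => i j; rewrite det_mx33 ord1.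
by move: i; apply: ord3_ind; rewrite !(mxE, sum_ord3) /=; ring.
Qed.

Lemma axial_rotated {R : realType} (M A : 'M[R]_3) :
  rotation M -> axial (M *m A *m M^T) = M *m axial A.
Proof.
move=> [oM dM].
by rewrite -[LHS]mul1mx -oM -mulmxA tr_mul_axial dM scale1r.
Qed.

Lemma curl_rotated {R : realType} (M : 'M[R]_3) (F : vfield R) :
  rotation M -> gateaux_field F -> curl (rotated M F) = rotated M (curl F).
Proof.
move=> rM dF; apply/funext => p; rewrite /rotated !curlE.
by have [_ ->] := rotated_jacobian M dF; rewrite axial_rotated.
Qed.

(** * Taylor components of a curl *)

Lemma smooth_partial {R : realType} (f : 'cV[R]_3 -> R) (i : 'I_3) :
  smooth f -> smooth (partial i f).
Proof.
case=> G jG ->; have [d0 d1 d2] := is_jet3_partial 0 0 0 jG.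
move: i; apply: ord3_ind; rewrite (d0, d1, d2).
- exact: ex_intro2 _ _ _ (is_jet3_shift 1 0 0 jG) _.
- exact: ex_intro2 _ _ _ (is_jet3_shift 0 1 0 jG) _.
- exact: ex_intro2 _ _ _ (is_jet3_shift 0 0 1 jG) _.
Qed.

Lemma smooth_comb {R : realType} (k : R) (f g : 'cV[R]_3 -> R) :
  smooth f -> smooth g -> smooth (fun p => f p + k * g p).
Proof.
move=> [F jF ->] [G jG ->].
exact: ex_intro2 _ _ _ (is_jet3D jF (is_jet3Z k jG)) _.
Qed.

Lemma taylor_coef_comb {R : realType} (k : R) (f g : 'cV[R]_3 -> R) a b c :
  smooth f -> smooth g ->
  taylor_coef (fun p => f p + k * g p) a b c = taylor_coef f a b c + k * taylor_coef g a b c.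
Proof.
move=> [F jF ->] [G jG ->].
rewrite (taylor_coef_jet3 _ _ _ (is_jet3D jF (is_jet3Z k jG))) !taylor_coef_jet3 //.
by rewrite mulrDl mulrA.
Qed.

Lemma taylor_part_comb {R : realType} (k : R) (f g : 'cV[R]_3 -> R) d p :
  smooth f -> smooth g ->
  taylor_part (fun p => f p + k * g p) d p = taylor_part f d p + k * taylor_part g d p.
Proof.
move=> sf sg; rewrite /taylor_part mulr_sumr -big_split; apply: eq_bigr => a _.
rewrite mulr_sumr -big_split; apply: eq_bigr => b _ /=.
rewrite mulr_sumr -big_split; apply: eq_bigr => c _ /=.
by rewrite taylor_coef_comb //; ring.
Qed.

(** Smoothness enters because the derivatives defining [taylor_coef] are taken in
    a fixed order: the extra one has to commute with them. *)
Lemma taylor_coef_partial {R : realType} (f : 'cV[R]_3 -> R) a b c : smooth f ->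
  [/\ taylor_coef (partial 0 f) a b c = a.+1%:R * taylor_coef f a.+1 b c,
      taylor_coef (partial 1 f) a b c = b.+1%:R * taylor_coef f a b.+1 c &
      taylor_coef (partial 2 f) a b c = c.+1%:R * taylor_coef f a b c.+1].
Proof.
case=> G jG ->; have [-> -> ->] := is_jet3_partial 0 0 0 jG.
rewrite !(taylor_coef_jet3 _ _ _ jG).
rewrite (taylor_coef_jet3 _ _ _ (is_jet3_shift 1 0 0 jG)).
rewrite (taylor_coef_jet3 _ _ _ (is_jet3_shift 0 1 0 jG)).
rewrite (taylor_coef_jet3 _ _ _ (is_jet3_shift 0 0 1 jG)).
have fN0 n : n`!%:R != 0 :> R by rewrite pnatr_eq0 -lt0n fact_gt0.
have sN0 n : n.+1%:R != 0 :> R by rewrite pnatr_eq0.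
rewrite !add0n !add1n; split; rewrite ?[_.+1`!]factS !natrM; field;
  by rewrite ?natr1 ?nat1r !(fN0, sN0).
Qed.

(** The sum over a + b + c = d, with a separate bound on each index: shifting an
    index by one then changes a single bound. *)
Definition hsum {R : realType} (N1 N2 N3 d : nat) (g : nat -> nat -> nat -> R) : R :=
  \sum_(a < N1) \sum_(b < N2) \sum_(c < N3 | (a + b + c == d)%N) g a b c.

Lemma sum_ord_widen {R : realType} m n (f : nat -> R) : (m <= n)%N ->
  (forall i, (m <= i)%N -> f i = 0) -> \sum_(i < m) f i = \sum_(i < n) f i.
Proof.
move=> mn f0; rewrite -!(big_mkord xpredT) [RHS](big_cat_nat (n := m)) //=.
rewrite [X in _ = _ + X]big_nat_cond [X in _ = _ + X]big1 ?addr0 // => i.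
by move=> /andP[/andP[mi _] _]; exact: f0.
Qed.

Lemma hsum_widen {R : realType} N1 N2 N3 d (g : nat -> nat -> nat -> R) :
  (d < N1)%N -> (d < N2)%N -> (d < N3)%N ->
  hsum d.+1 d.+1 d.+1 d g = hsum N1 N2 N3 d g.
Proof.
move=> d1 d2 d3; rewrite /hsum.
rewrite (sum_ord_widen (f := fun a =>
  \sum_(b < d.+1) \sum_(c < d.+1 | (a + b + c == d)%N) g a b c) d1).
  apply: eq_bigr => a _.
  rewrite (sum_ord_widen (f := fun b =>
    \sum_(c < d.+1 | (a + b + c == d)%N) g a b c) d2).
    apply: eq_bigr => b _; rewrite [LHS]big_mkcond [RHS]big_mkcond /=.
    rewrite (sum_ord_widen (f := fun c => if (a + b + c == d)%N then g a b c else 0) d3) //.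
    by move=> c dc; rewrite gtn_eqF //; lia.
  by move=> b db; rewrite big1 // => c /eqP; lia.
by move=> a da; rewrite big1 // => b _; rewrite big1 // => c /eqP; lia.
Qed.

Lemma hsum_shift0 {R : realType} d (g : nat -> nat -> nat -> R) :
  (forall b c, g 0%N b c = 0) ->
  hsum d.+2 d.+2 d.+2 d.+1 g = hsum d.+1 d.+1 d.+1 d (fun a => g a.+1).
Proof.
move=> g0; rewrite [RHS](@hsum_widen _ d.+1 d.+2 d.+2) // /hsum big_ord_recl big1 ?add0r.
  by do 2! [apply: eq_bigr => ? _]; apply: eq_bigl => ?; rewrite /= !addSn.
by move=> b _; rewrite big1.
Qed.

Lemma hsum_shift1 {R : realType} d (g : nat -> nat -> nat -> R) :
  (forall a c, g a 0%N c = 0) ->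
  hsum d.+2 d.+2 d.+2 d.+1 g = hsum d.+1 d.+1 d.+1 d (fun a b => g a b.+1).
Proof.
move=> g0; rewrite [RHS](@hsum_widen _ d.+2 d.+1 d.+2) // /hsum.
apply: eq_bigr => a _; rewrite big_ord_recl big1 ?add0r //.
by apply: eq_bigr => ? _; apply: eq_bigl => ?; rewrite /= addnS addSn.
Qed.

Lemma hsum_shift2 {R : realType} d (g : nat -> nat -> nat -> R) :
  (forall a b, g a b 0%N = 0) ->
  hsum d.+2 d.+2 d.+2 d.+1 g = hsum d.+1 d.+1 d.+1 d (fun a b c => g a b c.+1).
Proof.
move=> g0; rewrite [RHS](@hsum_widen _ d.+2 d.+2 d.+1) // /hsum.
do 2! [apply: eq_bigr => ? _].
rewrite !(big_mkcond (fun _ => _ == _)) big_ord_recl /= g0 if_same add0r.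
by apply: eq_bigr => ? _; rewrite addnS.
Qed.

Lemma eq_hsum {R : realType} d (g h : nat -> nat -> nat -> R) :
  (forall a b c, (a + b + c)%N = d -> g a b c = h a b c) ->
  hsum d.+1 d.+1 d.+1 d g = hsum d.+1 d.+1 d.+1 d h.
Proof.
move=> gh; apply: eq_bigr => a _; apply: eq_bigr => b _.
by apply: eq_bigr => c /eqP abc; exact: gh.
Qed.

Lemma hsumZ {R : realType} (k : R) N1 N2 N3 d g :
  hsum N1 N2 N3 d (fun a b c => k * g a b c) = k * hsum N1 N2 N3 d g.
Proof. by rewrite /hsum; do 3! [rewrite mulr_sumr; apply: eq_bigr => ? _]. Qed.

Lemma hsumE {R : realType} d (g : nat -> nat -> nat -> R) :
  hsum d.+1 d.+1 d.+1 d g =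
  \sum_(0 <= a < d.+1) \sum_(0 <= b < d.+1)
    if (a + b <= d)%N then g a b (d - (a + b))%N else 0.
Proof.
rewrite big_mkord; apply: eq_bigr => a _; rewrite big_mkord; apply: eq_bigr => b _.
case: ifP => ab; last by rewrite big1 // => c /eqP; lia.
rewrite (eq_bigl (fun c : 'I_d.+1 => c == (d - (a + b))%N :> nat)); last first.
  by move=> c /=; lia.
by rewrite big_ord1_eq ltnS leq_subr.
Qed.

Lemma taylor_part_hsum {R : realType} (f : 'cV[R]_3 -> R) d p :
  taylor_part f d p = hsum d.+1 d.+1 d.+1 d
    (fun a b c => taylor_coef f a b c * p 0 0 ^+ a * p 1 0 ^+ b * p 2 0 ^+ c).
Proof. by []. Qed.

Lemma taylor_part_e0 {R : realType} (f : 'cV[R]_3 -> R) d :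
  taylor_part f d (delta_mx 0 0) = taylor_coef f d 0 0.
Proof.
rewrite taylor_part_hsum hsumE !mxE /=.
rewrite big_nat_recr //= big_nat_recl //= addn0 leqnn subnn !expr0 expr1n !mulr1.
rewrite big_nat big1 ?add0r; last first.
  move=> a /andP[_ ad]; rewrite big_nat big1 // => b _; case: ifP => // ab.
  have [b0|b0] := eqVneq b 0%N; last by rewrite [0 ^+ b]expr0n (negbTE b0) mulr0 mul0r.
  by rewrite [X in _ * X]expr0n b0 addn0 subn_eq0 leqNgt ad /= mulr0.
by rewrite big1_seq ?addr0 // => b _; rewrite addnS ltnNge leq_addr.
Qed.

Definition monomial_jet {R : realType} (k : R) (i j l a b c : nat) (p : 'cV[R]_3) : R :=
  k * (pow_jet i a (p 0 0) * pow_jet j b (p 1 0) * pow_jet l c (p 2 0)).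

Definition taylor_jet {R : realType} (f : 'cV[R]_3 -> R) d a b c (p : 'cV[R]_3) : R :=
  hsum d.+1 d.+1 d.+1 d (fun i j l => monomial_jet (taylor_coef f i j l) i j l a b c p).

Lemma is_jet3_taylor {R : realType} (f : 'cV[R]_3 -> R) d : is_jet3 (taylor_jet f d).
Proof.
do 3! [apply: is_jet3_sum => ?]; apply: is_jet3Z.
by apply: is_jet3_prod; exact: is_jet_pow.
Qed.

Lemma taylor_partE {R : realType} (f : 'cV[R]_3 -> R) d :
  taylor_part f d = taylor_jet f d 0 0 0.
Proof.
apply/funext => p; do 3! [apply: eq_bigr => ? _].
by rewrite /monomial_jet /pow_jet !ffactn0 !subn0 !mul1r !mulrA.
Qed.

Lemma smooth_taylor_part {R : realType} (f : 'cV[R]_3 -> R) d : smooth (taylor_part f d).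
Proof. by exists (taylor_jet f d); [exact: is_jet3_taylor | exact: taylor_partE]. Qed.

Lemma partial_taylor_part {R : realType} (f : 'cV[R]_3 -> R) d : smooth f ->
  [/\ partial 0 (taylor_part f d.+1) = taylor_part (partial 0 f) d,
      partial 1 (taylor_part f d.+1) = taylor_part (partial 1 f) d &
      partial 2 (taylor_part f d.+1) = taylor_part (partial 2 f) d].
Proof.
move=> sf; rewrite taylor_partE.
have [-> -> ->] := is_jet3_partial 0 0 0 (is_jet3_taylor f d.+1).
have pow0 (t : R) : pow_jet 0 1 t = 0 by rewrite /pow_jet mul0r.
have pow1 n (t : R) : pow_jet n 0 t = t ^+ n by rewrite /pow_jet ffactn0 mul1r subn0.
have powS n (t : R) : pow_jet n.+1 1 t = n.+1%:R * t ^+ n.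
  by rewrite /pow_jet ffactn1 subSS subn0.
split; apply/funext => p; rewrite /taylor_jet [RHS]taylor_part_hsum.
- rewrite hsum_shift0 => [|b c]; last by rewrite /monomial_jet pow0; ring.
  apply: eq_hsum => i j l _; have [-> _ _] := taylor_coef_partial i j l sf.
  by rewrite /monomial_jet !pow1 powS; ring.
- rewrite hsum_shift1 => [|b c]; last by rewrite /monomial_jet pow0; ring.
  apply: eq_hsum => i j l _; have [_ -> _] := taylor_coef_partial i j l sf.
  by rewrite /monomial_jet !pow1 powS; ring.
- rewrite hsum_shift2 => [|b c]; last by rewrite /monomial_jet pow0; ring.
  apply: eq_hsum => i j l _; have [_ _ ->] := taylor_coef_partial i j l sf.
  by rewrite /monomial_jet !pow1 powS; ring.
Qed.

Lemma component_curl {R : realType} (F : vfield R) : let f := component F in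
  [/\ component (curl F) 0 = fun p => partial 1 (f 2) p + -1 * partial 2 (f 1) p,
      component (curl F) 1 = fun p => partial 2 (f 0) p + -1 * partial 0 (f 2) p &
      component (curl F) 2 = fun p => partial 0 (f 1) p + -1 * partial 1 (f 0) p].
Proof. by split; apply/funext => p; rewrite /component mxE /= mulN1r. Qed.

Lemma smooth_curl {R : realType} (F : vfield R) : smooth_field F -> smooth_field (curl F).
Proof.
move=> sF; have [c0 c1 c2] := component_curl F.
by apply: ord3_ind; rewrite (c0, c1, c2); apply: smooth_comb;
  apply: smooth_partial; apply: sF.
Qed.

Lemma component_taylor {R : realType} (F : vfield R) d i :
  component (taylor_component F d) i = taylor_part (component F i) d.
Proof. by apply/funext => p; rewrite /component mxE. Qed.

Lemma taylor_component_curl {R : realType} (F : vfield R) d : smooth_field F ->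
  taylor_component (curl F) d = curl (taylor_component F d.+1).
Proof.
move=> sF; have [c0 c1 c2] := component_curl F.
have sP i j : smooth (partial i (component F j)) by exact/smooth_partial/sF.
apply/funext => p; rewrite /curl !component_taylor.
have [p00 p01 p02] := partial_taylor_part d (sF 0).
have [p10 p11 p12] := partial_taylor_part d (sF 1).
have [p20 p21 p22] := partial_taylor_part d (sF 2).
apply/matrixP => i j; rewrite ord1 !mxE p01 p02 p10 p12 p20 p21 {j}.
by move: i; apply: ord3_ind; rewrite ?(c0, c1, c2) taylor_part_comb ?mulN1r.
Qed.

Lemma taylor_component_add {R : realType} (F G : vfield R) d p :
  smooth_field F -> smooth_field G ->
  taylor_component (Defs.addvf F G) d p = taylor_component F d p + taylor_component G d p.
Proof.
move=> sF sG; apply/matrixP => i j; rewrite ord1 !mxE {j}.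
rewrite -[taylor_part (component G i) d p]mul1r -taylor_part_comb //.
by congr taylor_part; apply/funext => q; rewrite /component mxE mul1r.
Qed.

Lemma taylor_only_odd_curl {R : realType} (F : vfield R) : smooth_field F ->
  taylor_only_even F -> taylor_only_odd (curl F).
Proof.
move=> sF eF i a b c even_abc; have [c0 c1 c2] := component_curl F.
have sP k j : smooth (partial k (component F j)) by exact/smooth_partial/sF.
have coef0 k j : taylor_coef (partial k (component F j)) a b c = 0.
  have [d0 d1 d2] := taylor_coef_partial a b c (sF j).
  by move: k; apply: ord3_ind; rewrite (d0, d1, d2) eF ?mulr0 // ?addnS ?addSn.
by move: i; apply: ord3_ind; rewrite (c0, c1, c2) taylor_coef_comb // !coef0 mulr0 addr0.
Qed.

(** * Cyclic fields with separable components *)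

(** The triple (m, s, k) stands for sin (k t) or cos (k t), according to [s],
    multiplied by t if [m] holds. *)
Definition factor (R : realType) : Type := bool * bool * R.

Definition factor_jet {R : realType} (f : factor R) : nat -> R -> R :=
  let: (m, s, k) := f in if m then mulX_jet (trig_jet s k) else trig_jet s k.

Lemma is_jet_factor {R : realType} (f : factor R) : is_jet (factor_jet f).
Proof.
by case: f => [[[] s] k]; [apply: is_jet_mulX|]; apply: is_jet_trig.
Qed.

Definition term (R : realType) : Type := R * (factor R * factor R * factor R).

Definition term_jet {R : realType} (t : term R) (a b c : nat) (x y z : R) : R :=
  let: (k, (f, g, h)) := t in
  k * (factor_jet f a x * factor_jet g b y * factor_jet h c z).

Definition terms_jet {R : realType} (l : seq (term R)) (a b c : nat) (x y z : R) : R :=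
  \sum_(t <- l) term_jet t a b c x y z.

Lemma is_jet3_terms0 {R : realType} (l : seq (term R)) :
  is_jet3 (fun a b c p => terms_jet l a b c (p 0 0) (p 1 0) (p 2 0)).
Proof.
apply: is_jet3_sum => -[k [[f g] h]]; apply: is_jet3Z.
by apply: is_jet3_prod; apply: is_jet_factor.
Qed.

Lemma is_jet3_terms1 {R : realType} (l : seq (term R)) :
  is_jet3 (fun a b c p => terms_jet l b c a (p 1 0) (p 2 0) (p 0 0)).
Proof.
apply: is_jet3_sum => -[k [[f g] h]]; apply: is_jet3Z => a b c p v.
have := is_jet3_prod (is_jet_factor h) (is_jet_factor f) (is_jet_factor g) a b c p v.
rewrite /=; under eq_fun do rewrite -mulrA mulrC.
by rewrite -!mulrA ![factor_jet h _ _ * _]mulrC -!mulrA.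
Qed.

Lemma is_jet3_terms2 {R : realType} (l : seq (term R)) :
  is_jet3 (fun a b c p => terms_jet l c a b (p 2 0) (p 0 0) (p 1 0)).
Proof.
apply: is_jet3_sum => -[k [[f g] h]]; apply: is_jet3Z => a b c p v.
have := is_jet3_prod (is_jet_factor g) (is_jet_factor h) (is_jet_factor f) a b c p v.
rewrite /=; under eq_fun do rewrite mulrC mulrA.
by rewrite ![_ * factor_jet f _ _]mulrC !mulrA.
Qed.

Lemma component_cyclic {R : realType} (g : R -> R -> R -> R) :
  [/\ component (cyclic_field g) 0 = fun p => g (p 0 0) (p 1 0) (p 2 0),
      component (cyclic_field g) 1 = fun p => g (p 1 0) (p 2 0) (p 0 0) &
      component (cyclic_field g) 2 = fun p => g (p 2 0) (p 0 0) (p 1 0)].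
Proof. by split; apply/funext => p; rewrite /component mxE. Qed.

Lemma smooth_cyclic_terms {R : realType} (l : seq (term R)) :
  smooth_field (cyclic_field (terms_jet l 0 0 0)).
Proof.
have [E0 E1 E2] := component_cyclic (terms_jet l 0 0 0).
by apply: ord3_ind; rewrite (E0, E1, E2);
  [exact: (ex_intro2 _ _ _ (is_jet3_terms0 l))
  |exact: (ex_intro2 _ _ _ (is_jet3_terms1 l))
  |exact: (ex_intro2 _ _ _ (is_jet3_terms2 l))].
Qed.

Lemma curl_cyclic_terms {R : realType} (l : seq (term R)) :
  curl (cyclic_field (terms_jet l 0 0 0)) =
  cyclic_field (fun x y z => terms_jet l 0 0 1 z x y - terms_jet l 0 1 0 y z x).
Proof.
have [E0 E1 E2] := component_cyclic (terms_jet l 0 0 0).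
rewrite /curl E0 E1 E2.
have [_ D01 D02] := is_jet3_partial 0 0 0 (is_jet3_terms0 l).
have [D10 _ D12] := is_jet3_partial 0 0 0 (is_jet3_terms1 l).
have [D20 D21 _] := is_jet3_partial 0 0 0 (is_jet3_terms2 l).
by rewrite D01 D02 D10 D12 D20 D21.
Qed.

Lemma rotated_cyclicE {R : realType} (M : 'M[R]_3) (f : R -> R -> R -> R)
    (p : 'cV[R]_3) (i : 'I_3) :
  let c j := M 0 j * p 0 0 + M 1 j * p 1 0 + M 2 j * p 2 0 in
  rotated M (cyclic_field f) p i 0 =
  M i 0 * f (c 0) (c 1) (c 2) + M i 1 * f (c 1) (c 2) (c 0) + M i 2 * f (c 2) (c 0) (c 1).
Proof. by rewrite /= mxE sum_ord3 !mxE /= !sum_ord3 !mxE. Qed.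

(** * The golden ratio and the generators of the icosahedral group *)

Lemma golden_eqs (R : realType) :
  let phi := golden R in
  [/\ phi != 0, phi ^+ 2 = phi + 1, phi^-1 = phi - 1 & Num.sqrt 5 = 2 * phi - 1].
Proof.
move=> phi; have s5 : Num.sqrt 5 ^+ 2 = 5 :> R by rewrite sqr_sqrtr.
have E : Num.sqrt 5 = 2 * phi - 1 by rewrite /phi /golden; field.
have phi2 : phi ^+ 2 = phi + 1 by move: s5; rewrite E; lra.
have phi0 : phi != 0.
  by apply: contra_eq_neq phi2 => ->; rewrite expr0n add0r eq_sym oner_eq0.
by split=> //; apply: (mulfI phi0); rewrite divff // mulrBr -expr2 phi2; ring.
Qed.

Lemma inv_double_golden (R : realType) : (2 * golden R)^-1 = (golden R - 1) / 2.
Proof. by have [phi0 _ <- _] := golden_eqs R; field. Qed.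

Lemma rotation_alpha (R : realType) : rotation (icos_alpha R).
Proof.
split; last by rewrite det_mx33 !mxE /=; ring.
by apply/matrixP; apply: ord3_ind; apply: ord3_ind; rewrite !(mxE, sum_ord3) /=; ring.
Qed.

Lemma rotation_beta (R : realType) : rotation (icos_beta R).
Proof.
split; last by rewrite det_mx33 !mxE /=; ring.
by apply/matrixP; apply: ord3_ind; apply: ord3_ind; rewrite !(mxE, sum_ord3) /=; ring.
Qed.

Lemma rotation_gamma (R : realType) : rotation (icos_gamma R).
Proof.
have [_ phi2 _ _] := golden_eqs R; have b := inv_double_golden R.
split; last by rewrite det_mx33 !mxE /= ?b ?div1r; field: phi2.
by apply/matrixP; apply: ord3_ind; apply: ord3_ind; rewrite !(mxE, sum_ord3) /=;
  rewrite ?b ?div1r; field: phi2.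
Qed.

Definition gamma2 (R : realType) : 'M[R]_3 :=
  let h : R := 1 / 2 in let a := golden R / 2 in let b := 1 / (2 * golden R) in
  mx3 [:: [:: - b; - h; a]; [:: h; - a; - b]; [:: a; b; h]].

Lemma gamma_mul_gamma (R : realType) : icos_gamma R *m icos_gamma R = gamma2 R.
Proof.
have [_ phi2 _ _] := golden_eqs R; have b := inv_double_golden R.
by apply/matrixP; apply: ord3_ind; apply: ord3_ind; rewrite !(mxE, sum_ord3) /=;
  rewrite ?b ?div1r; field: phi2.
Qed.

Lemma gamma2_mul_gamma (R : realType) : gamma2 R *m icos_gamma R = (gamma2 R)^T.
Proof.
have [_ phi2 _ _] := golden_eqs R; have b := inv_double_golden R.
by apply/matrixP; apply: ord3_ind; apply: ord3_ind; rewrite !(mxE, sum_ord3) /=;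
  rewrite ?b ?div1r; field: phi2.
Qed.

(** For the rotation [gamma], gamma^5 = 1 amounts to gamma^3 = (gamma^2)^T. *)
Lemma gamma_exp (R : realType) : let g := icos_gamma R in
  [/\ g ^+ 2 = gamma2 R, g ^+ 3 = (gamma2 R)^T, g ^+ 4 = g^T & g ^+ 5 = 1].
Proof.
move=> g; have rg := rotation_gamma R.
have g2 : g ^+ 2 = gamma2 R by rewrite expr2; exact: gamma_mul_gamma.
have g3 : g ^+ 3 = (gamma2 R)^T by rewrite exprSr g2; exact: gamma2_mul_gamma.
have g5 : g ^+ 5 = 1.
  rewrite (exprD g 3 2) g3 g2 -gamma_mul_gamma.
  by apply: rotation_trC; exact: rotationM.
split=> //; rewrite -[LHS]mulmx1 -rg.1 mulmxA.
by rewrite -[_ *m g]/(g ^+ 4 * g) -exprSr g5 mul1mx.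
Qed.

(** * The swirl and the decomposition of the field *)

(** In the swirl, each coordinate axis carries the plane wave
    A p sin (k . p), where k is the axis and the matrix A is
    2 phi e f^T - 2 phi^-1 f e^T for an orthonormal frame (k, e, f); such a wave
    has no divergence and its Laplacian is its opposite. *)
Definition swirl (R : realType) (x y z : R) : R :=
  2 * golden R * y * sin z - 2 * (golden R)^-1 * z * sin y.

Definition swirl_terms (R : realType) : seq (term R) :=
  [:: (2 * golden R, ((false, false, 0), (true, false, 0), (false, true, 1)));
      (- (2 * (golden R)^-1), ((false, false, 0), (false, true, 1), (true, false, 0)))].

Definition curl_swirl_terms (R : realType) : seq (term R) :=
  [:: (2 * golden R, ((true, false, 0), (false, false, 1), (false, false, 0)));
      (2 * (golden R)^-1, ((true, false, 0), (false, false, 0), (false, false, 1)));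
      (- (2 * Num.sqrt 5), ((false, true, 1), (false, false, 0), (false, false, 0)))].

Definition simplE := (big_cons, big_nil, mul0r, mul1r, cos0, sin0, mulr0, mulr1,
  expr0, expr1, add0r, addr0, subr0, sub0r, addn0, addn1, mulN1r, expr1n, uphalf_half).

Lemma swirl_termsE (R : realType) : @swirl R = terms_jet (swirl_terms R) 0 0 0.
Proof.
apply/funext => x; apply/funext => y; apply/funext => z.
rewrite /terms_jet /swirl_terms /term_jet /factor_jet /mulX_jet /trig_jet /sin_diff /=.
by rewrite !simplE /swirl; ring.
Qed.

Lemma smooth_swirl (R : realType) : smooth_field (cyclic_field (@swirl R)).
Proof. by rewrite swirl_termsE; exact: smooth_cyclic_terms. Qed.

Lemma curl_swirl (R : realType) :
  curl (cyclic_field (@swirl R)) = cyclic_field (terms_jet (curl_swirl_terms R) 0 0 0).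
Proof.
rewrite swirl_termsE curl_cyclic_terms; congr cyclic_field.
have [_ _ phiV s5] := golden_eqs R.
apply/funext => x; apply/funext => y; apply/funext => z.
rewrite /terms_jet /swirl_terms /curl_swirl_terms /term_jet.
rewrite /factor_jet /mulX_jet /trig_jet /sin_diff /=.
by rewrite !simplE s5 phiV; ring.
Qed.

Lemma curl_curl_swirl (R : realType) :
  curl (curl (cyclic_field (@swirl R))) = cyclic_field (@swirl R).
Proof.
rewrite curl_swirl curl_cyclic_terms swirl_termsE; congr cyclic_field.
apply/funext => x; apply/funext => y; apply/funext => z.
rewrite /terms_jet /swirl_terms /curl_swirl_terms /term_jet.
rewrite /factor_jet /mulX_jet /trig_jet /sin_diff /=.
by rewrite !simplE; ring.
Qed.

Lemma V0_gamma_sum (R : realType) : V0 R = fun p =>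
  \sum_(j < 5) rotated (icos_gamma R ^+ j) (cyclic_field (@swirl R)) p.
Proof.
have [g2 g3 g4 _] := gamma_exp R.
have [phi0 phi2 phiV s5] := golden_eqs R; have b := inv_double_golden R.
(* All arguments are brought to the form constant * coordinate, so that the
   sines and cosines on both sides become the same atoms. *)
have E1 t : golden R * t / 2 = golden R / 2 * t by rewrite mulrAC.
have E2 t : t / 2 = 2^-1 * t :> R by rewrite mulrC.
have E3 t : t / (2 * golden R) = (golden R - 1) / 2 * t by rewrite mulrC b.
apply/funext => p; apply/matrixP => i j; rewrite ord1 {j} summxE.
rewrite !big_ord_recl big_ord0 /= expr0 expr1 g2 g3 g4 !rotated_cyclicE.
move: i; apply: ord3_ind; rewrite [LHS]mxE /= /V0x !E1 !E3 ![p _ _ / 2]E2.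
all: move: (p 0 0) (p 1 0) (p 2 0) => x y z {p}.
all: rewrite !mxE /= !div1r b !mulNr !(mul0r,mul1r,add0r,addr0).
all: rewrite /swirl !(sinD, cosD, sinN, cosN) -exprVn phiV s5.
all: repeat move: (sin _) => ?; repeat move: (cos _) => ?.
all: by move: phi2; move: (golden R) => phi phi2; field: phi2.
Qed.

Definition V0_terms (R : realType) : seq (term R) :=
  let phi := golden R in let psi := phi^-1 in let s5 : R := Num.sqrt 5 in
  let S k := (false, true, k) in let C k := (false, false, k) in
  let XS k := (true, true, k) in let XC k := (true, false, k) in
  let h := 2^-1 in let a := phi / 2 in let b := (2 * phi)^-1 in
  [:: (2, (XS h, S a, S b)); (- (2 * phi), (XS b, S h, S a));
      (2 * psi, (XS a, S b, S h)); (2 * phi, (C 0, XC 0, S 1));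
      (7 - s5, (C h, XC a, S b)); (2 * phi ^+ 2, (C b, XC h, S a));
      (2 * s5, (C a, XC b, S h)); (- (2 * psi), (C 0, S 1, XC 0));
      (- (7 + s5), (C h, S a, XC b)); (- (2 * psi ^+ 2), (C a, S b, XC h));
      (- (2 * s5), (C b, S h, XC a))].

Lemma V0_termsE (R : realType) : @V0x R = terms_jet (V0_terms R) 0 0 0.
Proof.
apply/funext => x; apply/funext => y; apply/funext => z.
rewrite /terms_jet /V0_terms /term_jet /factor_jet /mulX_jet /trig_jet /sin_diff /=.
rewrite !simplE /V0x /=.
have E1 t : golden R * t / 2 = golden R / 2 * t by rewrite mulrAC.
have E2 t : t / 2 = 2^-1 * t :> R by rewrite mulrC.
have E3 t : t / (2 * golden R) = (2 * golden R)^-1 * t by rewrite mulrC.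
by rewrite !E1 !E3 [x / 2]E2 [y / 2]E2 [z / 2]E2 -exprVn; ring.
Qed.

Lemma V0_smooth (R : realType) : smooth_field (V0 R).
Proof. by rewrite /V0 V0_termsE; exact: smooth_cyclic_terms. Qed.

Lemma W0_smooth (R : realType) : smooth_field (W0 R).
Proof. exact/smooth_curl/V0_smooth. Qed.

Lemma curl_gamma_sum {R : realType} (F : vfield R) : gateaux_field F ->
  curl (fun p => \sum_(j < 5) rotated (icos_gamma R ^+ j) F p) =
  fun p => \sum_(j < 5) rotated (icos_gamma R ^+ j) (curl F) p.
Proof.
move=> dF; pose G j := rotated (icos_gamma R ^+ j) F.
have dG j : gateaux_field (G j) by have [] := rotated_jacobian (icos_gamma R ^+ j) dF.
have [_ ->] := gateaux_curl_sum 5 dG.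
apply/funext => p; apply: eq_bigr => j _; rewrite curl_rotated //.
exact/rotation_exp/rotation_gamma.
Qed.

Lemma curl_W0 (R : realType) : curl (W0 R) = V0 R.
Proof.
have sS := smooth_swirl R.
rewrite /W0 V0_gamma_sum curl_gamma_sum; last exact: smooth_gateaux.
by rewrite curl_gamma_sum ?curl_curl_swirl //; exact/smooth_gateaux/smooth_curl.
Qed.

Lemma curl_Y0 (R : realType) : curl (Y0 R) = Y0 R.
Proof.
rewrite /Y0 curlD; [|exact/smooth_gateaux/V0_smooth|exact/smooth_gateaux/W0_smooth].
by rewrite curl_W0; apply/funext => p; rewrite /Defs.addvf addrC.
Qed.

(** * Icosahedral symmetry *)

Lemma rotated_gamma_V0 (R : realType) : rotated (icos_gamma R) (V0 R) = V0 R.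
Proof.
have [_ _ _ g5] := gamma_exp R.
pose F j := rotated (icos_gamma R ^+ j) (cyclic_field (@swirl R)).
rewrite V0_gamma_sum (rotated_sum _ 5 F).
apply/funext => p; rewrite big_ord_recr [RHS]big_ord_recl addrC; congr (_ + _).
  by apply: eq_bigr => j _; rewrite /F -rotated_mul -[_ *m _]/(_ * _) -exprS.
by rewrite /F -rotated_mul -[_ *m _]/(_ * _) -exprS g5 expr0.
Qed.

Lemma rotated_alpha_V0 (R : realType) : rotated (icos_alpha R) (V0 R) = V0 R.
Proof.
apply/funext => p; apply/matrixP => i j; rewrite ord1 {j} rotated_cyclicE [RHS]mxE.
move: i; apply: ord3_ind; rewrite !mxE /=;
  move: (p 0 0) (p 1 0) (p 2 0) => x y z {p};
  by rewrite !(mul0r, mul1r, add0r, addr0, mulN1r) /V0x !(mulrN, mulNr, sinN, cosN); ring.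
Qed.

Lemma rotated_beta_V0 (R : realType) : rotated (icos_beta R) (V0 R) = V0 R.
Proof.
apply/funext => p; apply/matrixP => i j; rewrite ord1 {j} rotated_cyclicE [RHS]mxE.
move: i; apply: ord3_ind; rewrite !mxE /=;
  by rewrite !(mul0r, mul1r, add0r, addr0, mulN1r).
Qed.

Lemma rotated_Y0 {R : realType} (M : 'M[R]_3) :
  rotation M -> rotated M (V0 R) = V0 R -> rotated M (Y0 R) = Y0 R.
Proof.
move=> rM MV; have MW : rotated M (W0 R) = W0 R.
  by rewrite /W0 -curl_rotated ?MV //; exact/smooth_gateaux/V0_smooth.
apply/funext => p; rewrite /rotated /Y0 /Defs.addvf mulmxDr.
by congr (_ + _); [exact: (congr1 (@^~ p) MV) | exact: (congr1 (@^~ p) MW)].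
Qed.

Lemma icosahedral_Y0 {R : realType} (M : 'M[R]_3) : icosahedral M ->
  M \in unitmx /\ forall p, Y0 R (M *m p) = M *m Y0 R p.
Proof.
have gen N : rotation N -> rotated N (V0 R) = V0 R ->
    N \in unitmx /\ forall p, Y0 R (N *m p) = N *m Y0 R p.
  move=> rN NV; split; first by rewrite unitmxE rN.2 unitr1.
  by move=> p; rewrite -{1}(rotated_Y0 rN NV) /rotated mulmxA rotation_trC // mul1mx.
elim=> {M} [||||A B _ [uA eA] _ [uB eB]|A _ [uA eA]].
- exact: gen (rotation_alpha R) (rotated_alpha_V0 R).
- exact: gen (rotation_beta R) (rotated_beta_V0 R).
- exact: gen (rotation_gamma R) (rotated_gamma_V0 R).
- by split=> [|p]; rewrite ?unitmx1 ?mul1mx.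
- by split=> [|p]; rewrite ?unitmx_mul ?uA // -!mulmxA eA eB.
- by split=> [|p]; rewrite ?unitmx_inv // -[LHS](mulKmx uA) -eA mulKVmx.
Qed.

Lemma icosahedral_symmetry_Y0 (R : realType) : icosahedral_symmetry (Y0 R).
Proof. by move=> M /icosahedral_Y0 [uM eM] p; rewrite eM mulKmx. Qed.

(** * The Taylor coefficients of the field *)

Definition V0_coef (R : realType) a b c : R := terms_jet (V0_terms R) a b c 0 0 0.

Lemma taylor_coef_V0 (R : realType) a b c : let N : R := (a`! * b`! * c`!)%N%:R in
  [/\ taylor_coef (component (V0 R) 0) a b c = V0_coef R a b c / N,
      taylor_coef (component (V0 R) 1) a b c = V0_coef R b c a / N &
      taylor_coef (component (V0 R) 2) a b c = V0_coef R c a b / N].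
Proof.
have [E0 E1 E2] := component_cyclic (terms_jet (V0_terms R) 0 0 0).
rewrite /V0 V0_termsE E0 E1 E2.
by split; rewrite (taylor_coef_jet3 _ _ _ (is_jet3_terms0 _),
  taylor_coef_jet3 _ _ _ (is_jet3_terms1 _), taylor_coef_jet3 _ _ _ (is_jet3_terms2 _)) !mxE.
Qed.

Lemma trig_jet0 {R : realType} s (k : R) n :
  trig_jet s k n 0 = if odd n == s then (-1) ^+ n./2 * k ^+ n else 0.
Proof.
rewrite /trig_jet /sin_diff mulr0 sin0 cos0 oddD.
case: s => /=; rewrite ?addn0 ?addn1 /= ?uphalf_half; case: (odd n) => /=;
  by rewrite ?mulr0 ?mulr1 // mulrC.
Qed.

Lemma mulX_trig_jet0 {R : realType} s (k : R) n :
  mulX_jet (trig_jet s k) n 0 =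
  if odd n != s then (-1) ^+ n.-1./2 * n%:R * k ^+ n.-1 else 0.
Proof.
rewrite /mulX_jet mul0r add0r trig_jet0; case: n => [|n] /=.
  by rewrite mul0r; case: ifP; rewrite // mulr0 mul0r.
by case: (odd n); case: s => /=; rewrite ?mulr0 //; ring.
Qed.

(** Each of the eleven terms is even in x and odd in y and in z. *)
Lemma V0_coef_parity (R : realType) a b c :
  odd a || ~~ odd b || ~~ odd c -> V0_coef R a b c = 0.
Proof.
move=> abc; rewrite /V0_coef /terms_jet /V0_terms !big_cons big_nil.
rewrite /term_jet /factor_jet !trig_jet0 !mulX_trig_jet0.
by move: abc; case: (odd a); case: (odd b); case: (odd c) => //= _; ring.
Qed.

Lemma V0_only_even (R : realType) : taylor_only_even (V0 R).
Proof.
move=> i a b c; have [c0 c1 c2] := taylor_coef_V0 R a b c; rewrite !oddD => abc.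
move: i; apply: ord3_ind; rewrite (c0, c1, c2) V0_coef_parity ?mul0r //;
  by move: abc; case: (odd a); case: (odd b); case: (odd c).
Qed.

(** The eleven contributions in the order of [V0_terms], without their signs
    (-1)^i, (-1)^j, (-1)^l; phi^-1 and sqrt 5 are written as phi - 1 and
    2 phi - 1, so that the value is a polynomial in phi.  For a = 0 the
    truncated a.-1 is harmless, being multiplied by a. *)
Definition V0_coef_abs (R : realType) (a b c : nat) : R :=
  let phi := golden R in let psi := phi - 1 in let s5 := 2 * phi - 1 in
  let h := 2^-1 in let u := phi / 2 in let v := psi / 2 in
  - 2 * (a%:R * h ^+ a.-1 * u ^+ b * v ^+ c)
  + 2 * phi * (a%:R * v ^+ a.-1 * h ^+ b * u ^+ c)
  - 2 * psi * (a%:R * u ^+ a.-1 * v ^+ b * h ^+ c)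
  + 2 * phi * (0 ^+ a * (b%:R * 0 ^+ b.-1))
  + (7 - s5) * (h ^+ a * (b%:R * u ^+ b.-1) * v ^+ c)
  + 2 * phi ^+ 2 * (v ^+ a * (b%:R * h ^+ b.-1) * u ^+ c)
  + 2 * s5 * (u ^+ a * (b%:R * v ^+ b.-1) * h ^+ c)
  - 2 * psi * (0 ^+ a * (c%:R * 0 ^+ c.-1))
  - (7 + s5) * (h ^+ a * u ^+ b * (c%:R * v ^+ c.-1))
  - 2 * psi ^+ 2 * (u ^+ a * v ^+ b * (c%:R * h ^+ c.-1))
  - 2 * s5 * (v ^+ a * h ^+ b * (c%:R * u ^+ c.-1)).

Lemma V0_coefE (R : realType) i j l :
  V0_coef R i.*2 j.*2.+1 l.*2.+1 =
  (-1) ^+ (i + j + l) * V0_coef_abs R i.*2 j.*2.+1 l.*2.+1.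
Proof.
have [_ _ phiV s5] := golden_eqs R.
rewrite /V0_coef /terms_jet /V0_terms !big_cons big_nil.
rewrite /term_jet /factor_jet !trig_jet0 !mulX_trig_jet0 /= !odd_double /= !doubleK.
rewrite !uphalf_double inv_double_golden phiV s5 /V0_coef_abs !expr1n !exprD.
case: i => [|i]; first by rewrite double0 /=; ring.
rewrite doubleS /= uphalf_double ![(-1) ^+ i.+1]exprS ![0 ^+ i.*2.+2]expr0n.
by ring.
Qed.

(** The coefficient of x^(2i) y^(2j+1) z^(2l+1) in [varpi0], with sqrt 5 as a
    polynomial in the golden ratio. *)
Definition varpi_coef (R : realType) (i j l : nat) : R :=
  let s5 := 2 * golden R - 1 in
  match i, j, l with
  | 4%N, 0%N, 0%N => - 18
  | 3%N, 1%N, 0%N => 84 + 84 * s5 | 3%N, 0%N, 1%N => 84 - 84 * s5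
  | 2%N, 2%N, 0%N => - (126 + 126 * s5) | 2%N, 0%N, 2%N => - (126 - 126 * s5)
  | 1%N, 3%N, 0%N => 36 + 108 * s5 | 1%N, 0%N, 3%N => 36 - 108 * s5
  | 1%N, 2%N, 1%N => - (504 * s5) | 1%N, 1%N, 2%N => 504 * s5
  | 0%N, 4%N, 0%N => 9 - 5 * s5 | 0%N, 0%N, 4%N => 9 + 5 * s5
  | 0%N, 3%N, 1%N => - (120 - 24 * s5) | 0%N, 1%N, 3%N => - (120 + 24 * s5)
  | 0%N, 2%N, 2%N => 252
  | _, _, _ => 0
  end.

Lemma norm_const_neq0 (R : realType) : norm_const R != 0.
Proof. by rewrite /norm_const gt_eqF //; lra. Qed.

(** Finitely many triples (i, j, l) remain, and for each of them both this identity
    and [V0_coef_top] are polynomial identities modulo phi^2 = phi + 1. *)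
Lemma V0_coef_low (R : realType) i j l : (i + j + l < 4)%N ->
  V0_coef_abs R i.*2 j.*2.+1 l.*2.+1 = 0.
Proof.
have [_ phi2 _ _] := golden_eqs R.
move=> lt4; have : [&& i < 4, j < 4 & l < 4]%N by lia.
rewrite /V0_coef_abs; case/and3P; move: lt4.
case: i => [|[|[|[|//]]]]; case: j => [|[|[|[|//]]]] //;
  case: l => [|[|[|[|//]]]] //= _ _ _ _;
  rewrite !(doubleS, double0) /= ?expr0 ?[0 ^+ _]expr0n /=; by field: phi2.
Qed.

Lemma V0_coef_top (R : realType) i j l : (i + j + l = 4)%N ->
  V0_coef_abs R i.*2 j.*2.+1 l.*2.+1 * norm_const R =
  varpi_coef R i j l * (i.*2`! * j.*2.+1`! * l.*2.+1`!)%N%:R.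
Proof.
have [_ phi2 _ _] := golden_eqs R.
move=> eq4; have : [&& i < 5, j < 5 & l < 5]%N by lia.
rewrite /V0_coef_abs /norm_const; case/and3P; move: eq4.
case: i => [|[|[|[|[|//]]]]]; case: j => [|[|[|[|[|//]]]]] //;
  case: l => [|[|[|[|[|//]]]]] //= _ _ _ _;
  rewrite !(doubleS, double0) /= ?expr0 ?[0 ^+ _]expr0n /= !factS fact0 !natrM;
  by field: phi2.
Qed.

Lemma even_odd_oddP a b c :
  reflect (exists i j l, [/\ a = i.*2, b = j.*2.+1 & c = l.*2.+1])
    [&& ~~ odd a, odd b & odd c].
Proof.
apply: (iffP and3P) => [[/negbTE ea ob oc]|[i [j [l [-> -> ->]]]]]; last first.
  by rewrite /= !odd_double.
by exists a./2, b./2, c./2; split; rewrite -[LHS]odd_double_half ?(ea, ob, oc).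
Qed.

Lemma V0_coef_lt10 (R : realType) a b c : (a + b + c < 10)%N -> V0_coef R a b c = 0.
Proof.
have [/even_odd_oddP[i [j [l [-> -> ->]]]] lt10|] := boolP [&& ~~ odd a, odd b & odd c].
  by rewrite V0_coefE V0_coef_low ?mulr0 //; lia.
move=> np _; apply: V0_coef_parity.
by move: np; case: (odd a); case: (odd b); case: (odd c).
Qed.

Definition varpi_coef3 (R : realType) (a b c : nat) : R :=
  if [&& ~~ odd a, odd b & odd c] then varpi_coef R a./2 b./2 c./2 else 0.

Lemma V0_coef_eq10 (R : realType) a b c : (a + b + c = 10)%N ->
  V0_coef R a b c / (a`! * b`! * c`!)%N%:R = (norm_const R)^-1 * varpi_coef3 R a b c.
Proof.
rewrite /varpi_coef3.
case: ifPn => [/even_odd_oddP[i [j [l [-> -> ->]]]] eq10|np _]; last first.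
  rewrite V0_coef_parity ?mul0r ?mulr0 //.
  by move: np; case: (odd a); case: (odd b); case: (odd c).
have eq4 : (i + j + l = 4)%N by lia.
rewrite V0_coefE eq4 /= !uphalf_double doubleK !(exprS, expr0) !mulN1r !opprK mul1r.
have fN0 : (i.*2`! * j.*2.+1`! * l.*2.+1`!)%N%:R != 0 :> R.
  by rewrite pnatr_eq0 -lt0n !muln_gt0 !fact_gt0.
apply: (mulIf fN0); rewrite divfK //; apply: (mulIf (norm_const_neq0 R)).
by rewrite V0_coef_top // [RHS]mulrC -[in RHS]mulrA mulVKf // norm_const_neq0.
Qed.

Lemma taylor_coef_V0_eq10 (R : realType) a b c : (a + b + c = 10)%N ->
  let k := (norm_const R)^-1 in
  [/\ taylor_coef (component (V0 R) 0) a b c = k * varpi_coef3 R a b c,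
      taylor_coef (component (V0 R) 1) a b c = k * varpi_coef3 R b c a &
      taylor_coef (component (V0 R) 2) a b c = k * varpi_coef3 R c a b].
Proof.
move=> abc; have [-> -> ->] := taylor_coef_V0 R a b c; split.
- exact: V0_coef_eq10.
- by rewrite -V0_coef_eq10; [congr (_ / _%:R); lia | lia].
- by rewrite -V0_coef_eq10; [congr (_ / _%:R); lia | lia].
Qed.

Lemma varpi_hsum (R : realType) (x y z : R) :
  let f := @varpi_coef3 R in
  [/\ hsum 11 11 11 10 (fun a b c => f a b c * x ^+ a * y ^+ b * z ^+ c) = varpi0 x y z,
      hsum 11 11 11 10 (fun a b c => f b c a * x ^+ a * y ^+ b * z ^+ c) = varpi0 y z x &
      hsum 11 11 11 10 (fun a b c => f c a b * x ^+ a * y ^+ b * z ^+ c) = varpi0 z x y].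
Proof.
have [_ _ _ s5] := golden_eqs R.
by split; rewrite hsumE unlock /= /varpi_coef3 /varpi0 /= s5; ring.
Qed.

Lemma taylor_component_V0_10 (R : realType) : taylor_component (V0 R) 10 = P0n R.
Proof.
apply/funext => p; apply/matrixP => i j; rewrite ord1 {j} !mxE taylor_part_hsum.
have [h0 h1 h2] := varpi_hsum (p 0 0) (p 1 0) (p 2 0).
move: i; apply: ord3_ind => /=; rewrite -(h0, h1, h2) -hsumZ; apply: eq_hsum => a b c abc;
  by have [c0 c1 c2] := taylor_coef_V0_eq10 R abc; rewrite (c0, c1, c2) !mulrA.
Qed.

Lemma taylor_component_V0_lt10 (R : realType) d p :
  (d < 10)%N -> taylor_component (V0 R) d p = 0.
Proof.
move=> d10; apply/matrixP => i j; rewrite ord1 {j} !mxE.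
rewrite /taylor_part; apply: big1 => a _; apply: big1 => b _; apply: big1 => c /eqP abc.
have [c0 c1 c2] := taylor_coef_V0 R a b c.
by move: i; apply: ord3_ind; rewrite (c0, c1, c2) V0_coef_lt10 ?mul0r //; lia.
Qed.

(** * Leading terms *)

Lemma P0n_gateaux (R : realType) : gateaux_field (P0n R).
Proof.
rewrite -taylor_component_V0_10; apply: smooth_gateaux => i.
by rewrite component_taylor; exact: smooth_taylor_part.
Qed.

Lemma Q0nE (R : realType) : Q0n R = curl (P0n R).
Proof.
have -> : Q0n R = scalevf (norm_const R)^-1 (curl (P0 R)) by [].
have P0E : P0 R = scalevf (norm_const R) (P0n R).
  by apply/funext => p; rewrite /P0n /scalevf scalerA divff ?norm_const_neq0 // scale1r.
rewrite P0E curl_scale; last exact: P0n_gateaux.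
by apply/funext => p; rewrite /scalevf scalerA mulVf ?norm_const_neq0 // scale1r.
Qed.

Lemma taylor_component_W0_9 (R : realType) : taylor_component (W0 R) 9 = Q0n R.
Proof.
by rewrite Q0nE -taylor_component_V0_10 taylor_component_curl //; exact: V0_smooth.
Qed.

Lemma taylor_component_W0_lt9 (R : realType) d p :
  (d < 9)%N -> taylor_component (W0 R) d p = 0.
Proof.
move=> d9; rewrite taylor_component_curl; last exact: V0_smooth.
have -> : taylor_component (V0 R) d.+1 = fun _ => 0.
  by apply/funext => q; exact: taylor_component_V0_lt10.
by rewrite gateaux_curl0.2.
Qed.

Lemma P0n_neq0 (R : realType) : P0n R (vec3 0 1 1) <> 0.
Proof.
move=> /matrixP/(_ 0 0); rewrite !mxE /= => /eqP.
rewrite mulf_eq0 invr_eq0 (negbTE (norm_const_neq0 R)) /= /varpi0.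
by apply/negP/eqP; lra.
Qed.

(** At (1, 0, 0) only the coefficient of x^9 survives in the first component of
    Q.  It is the difference of the coefficients of x^9 y in the third and of
    x^9 z in the second component of P, namely
    (9 - 5 sqrt 5) - (9 + 5 sqrt 5). *)
Lemma curl_P0n_neq0 (R : realType) : curl (P0n R) (delta_mx 0 0) <> 0.
Proof.
rewrite -Q0nE -taylor_component_W0_9 => /matrixP/(_ 0 0); rewrite !mxE taylor_part_e0.
have sV := V0_smooth R; have [-> _ _] := component_curl (V0 R).
rewrite taylor_coef_comb; try exact/smooth_partial/sV.
have [_ -> _] := taylor_coef_partial 9 0 0 (sV 2).
have [_ _ ->] := taylor_coef_partial 9 0 0 (sV 1).
have [_ _ ->] := taylor_coef_V0_eq10 R (erefl : (9 + 1 + 0 = 10)%N).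
have [_ -> _] := taylor_coef_V0_eq10 R (erefl : (9 + 0 + 1 = 10)%N).
have [_ _ _ s5] := golden_eqs R.
have s5N0 : Num.sqrt 5 != 0 :> R by rewrite sqrtr_eq0 -ltNge.
rewrite /varpi_coef3 /= -s5 => /eqP.
have -> : 1 * ((norm_const R)^-1 * (9 - 5 * Num.sqrt 5)) +
    -1 * (1 * ((norm_const R)^-1 * (9 + 5 * Num.sqrt 5)))
    = - 10 * (norm_const R)^-1 * Num.sqrt 5 by ring.
rewrite !mulf_eq0 invr_eq0 (negbTE (norm_const_neq0 R)) (negbTE s5N0).
by rewrite oppr_eq0 pnatr_eq0.
Qed.

Theorem theorem2 (R : realType) :
  taylor_only_even (V0 R) /\
  taylor_only_odd (W0 R) /\
  icosahedral_symmetry (Y0 R) /\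
  curl (Y0 R) = Y0 R /\
  taylor_starts_with (V0 R) 10 (P0n R) /\
  taylor_starts_with (Y0 R) 9 (Q0n R) /\
  Q0n R = curl (P0n R) /\
  exists p : 'cV[R]_3, curl (P0n R) p <> 0.
Proof.
have sV := V0_smooth R; have sW := W0_smooth R.
split; first exact: V0_only_even.
split; first exact/taylor_only_odd_curl/V0_only_even.
split; first exact: icosahedral_symmetry_Y0.
split; first exact: curl_Y0.
split; [split | split; [split | split; [exact: Q0nE|]]].
- exact: taylor_component_V0_lt10.
- by move=> p; rewrite taylor_component_V0_10.
- by exists (vec3 0 1 1); exact: P0n_neq0.
- move=> d p d9; rewrite taylor_component_add // taylor_component_V0_lt10 ?(leq_trans d9) //.
  by rewrite taylor_component_W0_lt9 ?addr0.
- move=> p; rewrite taylor_component_add // taylor_component_V0_lt10 //.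
  by rewrite taylor_component_W0_9 add0r.
- by exists (delta_mx 0 0); rewrite Q0nE; exact: curl_P0n_neq0.
- by exists (delta_mx 0 0); exact: curl_P0n_neq0.
Qed.
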